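(* Let $\tau=(1,\tau)\sigma$, $\delta=(\delta,\delta)\sigma$, $F$ the finitary group, and $G=\langle F,\tau\rangle\le W$. Let $T=\{\tau^x:x\in\mathbb Z_2\}$ and $D=\langle\delta\rangle\cong\mathbb Z/2$. Then: (1) $G$ is a countable layered group and $G/G'\cong\mathbb Z\oplus(\mathbb Z/2)^\infty$; (2) $N_W(G)=\langle F,T\rangle D$; (3) $N_W^2(G)=N_W(G)$.
   Context: $W$ is the isometry group of the binary rooted tree $X^*$, $X=\{0,1\}$. Elements are written $(g_0,g_1)\pi$, meaning $(xw)^{(g_0,g_1)\pi}=x^\pi w^{g_x}$; $\sigma$ is the transposition at the root. For $v\in X^*$, $g\in W$, $v*g$ acts as $g$ on the subtree below $v$ and fixes other vertices. The finitary group is $F=\langle v*\sigma:v\in X^*\rangle$. For $x\in\mathbb Z_2$ (2-adic integers), $\tau^x$ is defined recursively by $\tau^x=(\tau^{x/2},\tau^{x/2})$ for $x\in2\mathbb Z_2$ and $\tau^x=(\tau^{(x-1)/2},\tau^{(x+1)/2})\sigma$ for $x\in2\mathbb Z_2+1$. A subgroup is layered if it is transitive on each level and $x*G\le G$ for $x\in X$. $N_W^2(G)=N_W(N_W(G))$. $(\mathbb Z/2)^\infty$ denotes a countably infinite elementary abelian $2$-group. *)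

(* Defs.v *)
(* The binary rooted tree X^* with X = {0,1} is [list bool]
   (false = 0, true = 1; a vertex x::w is the word "x w").
   An element of W (isometry group of the tree) is represented by its
   PORTRAIT: g v = true iff g acts as the root transposition sigma at
   vertex v.  Every function list bool -> bool is an element of W and
   conversely, so W is the whole type [W]. *)
From Stdlib Require Import List Bool ZArith.
Import ListNotations.

Definition W := list bool -> bool.

Definition sec (g : W) (x : bool) : W := fun u => g (x :: u).

Fixpoint act (g : W) (v : list bool) : list bool :=
  match v with
  | [] => []
  | x :: w => xorb x (g []) :: act (sec g x) w
  end.

(* product g*h : first g then h (right actions), v^(gh) = (v^g)^h *)
Definition mul (g h : W) : W := fun v => xorb (g v) (h (act g v)).

Fixpoint pre (g : W) (v : list bool) : list bool :=
  match v with
  | [] => []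
  | y :: w => let x := xorb y (g []) in x :: pre (sec g x) w
  end.

Definition inv (g : W) : W := fun v => g (pre g v).
Definition one : W := fun _ => false.

Definition sigma : W := fun v => match v with [] => true | _ => false end.

Fixpoint strip (v w : list bool) : option (list bool) :=
  match v, w with
  | [], _ => Some w
  | a :: v', b :: w' => if Bool.eqb a b then strip v' w' else None
  | _ :: _, [] => None
  end.

Definition vstar (v : list bool) (g : W) : W :=
  fun w => match strip v w with Some u => g u | None => false end.

Inductive gen (S : W -> Prop) : W -> Prop :=
  | gen_base : forall g, S g -> gen S g
  | gen_one : gen S one
  | gen_mul : forall g h, gen S g -> gen S h -> gen S (mul g h)
  | gen_inv : forall g, gen S g -> gen S (inv g).

Definition Fin : W -> Prop := gen (fun g => exists v, g = vstar v sigma).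

(* tau = (1, tau) sigma : portrait is true exactly on the words 1...1 *)
Definition tau : W := fun v => forallb (fun b => b) v.
(* delta = (delta, delta) sigma : portrait is constantly true *)
Definition delta : W := fun _ => true.

Definition G : W -> Prop := gen (fun g => Fin g \/ g = tau).

(* 2-adic integers as bit streams: x = sum_i x_i 2^i *)
Definition Z2 := nat -> bool.
Definition half (x : Z2) : Z2 := fun i => x (S i).
Definition succ2 (x : Z2) : Z2 :=
  fun i => xorb (x i) (forallb x (seq 0 i)).

(* tau^x : tau^x = (tau^{x/2}, tau^{x/2}) if x even,
   (tau^{(x-1)/2}, tau^{(x+1)/2}) sigma if x odd.  For odd x,
   (x-1)/2 = half x and (x+1)/2 = succ2 (half x). *)
Fixpoint tpow (x : Z2) (v : list bool) {struct v} : bool :=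
  match v with
  | [] => x 0
  | a :: w => tpow (if x 0 && a then succ2 (half x) else half x) w
  end.

Definition T : W -> Prop := fun g => exists x : Z2, g = tpow x.
Definition D : W -> Prop := gen (fun g => g = delta).

Definition normalizer (H : W -> Prop) : W -> Prop :=
  fun g => forall h, H h <-> H (mul (mul (inv g) h) g).

Definition layered (H : W -> Prop) : Prop :=
  (forall u v : list bool, length u = length v ->
     exists g, H g /\ act g u = v) /\
  (forall (x : bool) g, H g -> H (vstar [x] g)).

Definition countable_set (H : W -> Prop) : Prop :=
  exists f : nat -> W, forall g, H g -> exists n, f n = g.

Definition comm (a b : W) : W := mul (mul (inv a) (inv b)) (mul a b).
Definition derived (H : W -> Prop) : W -> Prop :=
  gen (fun c => exists a b, H a /\ H b /\ c = comm a b).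

(* Z (+) (Z/2)^infinity, realised as pairs (z, s) with s : nat -> bool
   finitely supported; group law (z,s)+(z',s') = (z+z', s xor s'). *)
Definition fin_supp (s : nat -> bool) : Prop :=
  exists N, forall n, N <= n -> s n = false.
Definition addA (a b : Z * (nat -> bool)) : Z * (nat -> bool) :=
  ((fst a + fst b)%Z, fun n => xorb (snd a n) (snd b n)).
Definition zeroA : Z * (nat -> bool) := (0%Z, fun _ => false).

(* H / H' is isomorphic to Z (+) (Z/2)^infinity : there is a homomorphism
   from H onto that group with kernel exactly H' (first isomorphism thm). *)
Definition abelianization_is_Z_plus_Z2inf (H : W -> Prop) : Prop :=
  exists phi : W -> Z * (nat -> bool),
    (forall g h, H g -> H h -> phi (mul g h) = addA (phi g) (phi h)) /\
    (forall g, H g -> fin_supp (snd (phi g))) /\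
    (forall z s, fin_supp s -> exists g, H g /\ phi g = (z, s)) /\
    (forall g, H g -> (phi g = zeroA <-> derived H g)).

(* Main.v *)
(** The idea is that [G] consists of the portraits whose sections at some level
    are integer powers of [tau]; the sum of these exponents together with the
    parities of the levels gives the abelianization.  If [g] normalizes [G] then
    comparing [tau^(2^n)] with its conjugate shows that the sections of [g] at a
    deep level all conjugate [tau] to the same [tau^e] with [e = 1] or [e = -1];
    so, up to [delta], they centralize [tau], that is, they lie in [T], and they
    agree modulo [G].  An element normalizing the normalizer of [G] has sections
    normalizing [G], because [x * h] normalizes [G] only if [h] is in [G]; the
    two sections are then compared modulo [G]. *)
Require Import Defs.
From Stdlib Require Import List Bool ZArith.
From Stdlib Require Import Lia FunctionalExtensionality ClassicalEpsilon Cantor.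
Import ListNotations.

Local Infix "**" := mul (at level 40, left associativity).

(** * The group of portraits *)

Lemma mul_root g h : (g ** h) [] = xorb (g []) (h []).
Proof. reflexivity. Qed.

Lemma sec_mul g h x : sec (g ** h) x = sec g x ** sec h (xorb x (g [])).
Proof. reflexivity. Qed.

Lemma inv_root g : inv g [] = g [].
Proof. reflexivity. Qed.

Lemma sec_inv g x : sec (inv g) x = inv (sec g (xorb x (g []))).
Proof. reflexivity. Qed.

Lemma sec_one x : sec one x = one.
Proof. reflexivity. Qed.

Lemma sec_sigma x : sec sigma x = one.
Proof. reflexivity. Qed.

Lemma sec_delta x : sec delta x = delta.
Proof. reflexivity. Qed.

Lemma sec_tau x : sec tau x = if x then tau else one.
Proof. now destruct x. Qed.

Lemma sec_vstar1 x g y : sec (vstar [x] g) y = if eqb x y then g else one.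
Proof.
  apply functional_extensionality; intro w.
  unfold sec, vstar, one; simpl; now destruct (eqb x y).
Qed.

Lemma vstar_nil g : vstar [] g = g.
Proof. reflexivity. Qed.

Lemma vstar_cons x v g : vstar (x :: v) g = vstar [x] (vstar v g).
Proof.
  apply functional_extensionality; intros [|y w]; [reflexivity|].
  unfold vstar; simpl; now destruct (eqb x y).
Qed.

Lemma W_ext g h :
  g [] = h [] -> (forall x, sec g x = sec h x) -> g = h.
Proof.
  intros H0 H; apply functional_extensionality; intros [|x w]; [exact H0|].
  exact (equal_f (H x) w).
Qed.

(** Coinduction on portraits: elements such as [tau], [delta] and inverses are self-similar, so an
    identity between them follows from a relation that is stable under sections and forces equal
    root labels. *)
Lemma bisim (R : W -> W -> Prop) :
  (forall g h, R g h -> g [] = h [] /\ forall x, R (sec g x) (sec h x)) ->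
  forall g h, R g h -> g = h.
Proof.
  intros HR g h H; apply functional_extensionality; intro v; revert g h H.
  induction v as [|x v IH]; intros g h H; destruct (HR g h H) as [H0 Hs].
  - exact H0.
  - exact (IH _ _ (Hs x)).
Qed.

Lemma act_mul g h v : act (g ** h) v = act h (act g v).
Proof.
  revert g h; induction v as [|x v IH]; intros g h; [reflexivity|].
  cbn [act]; rewrite sec_mul, IH, mul_root.
  f_equal; destruct x, (g []), (h []); reflexivity.
Qed.

Lemma mulA f g h : f ** g ** h = f ** (g ** h).
Proof.
  apply functional_extensionality; intro v.
  unfold mul at 1 3; rewrite act_mul; unfold mul; apply xorb_assoc.
Qed.

Lemma act_one v : act one v = v.
Proof.
  induction v as [|x v IH]; [reflexivity|].
  cbn [act]; rewrite sec_one, IH; now destruct x.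
Qed.

Lemma mul1g g : one ** g = g.
Proof.
  apply functional_extensionality; intro v; unfold mul; rewrite act_one.
  now unfold one; destruct (g v).
Qed.

Lemma mulg1 g : g ** one = g.
Proof. apply functional_extensionality; intro v; apply xorb_false_r. Qed.

Lemma mulVg g : inv g ** g = one.
Proof.
  apply (bisim (fun a b => exists g, a = inv g ** g /\ b = one)); [|eauto].
  intros a b [f [-> ->]]; split.
  - apply xorb_nilpotent.
  - intro x; rewrite sec_mul, sec_inv, inv_root; eauto.
Qed.

Lemma mulgV g : g ** inv g = one.
Proof.
  apply (bisim (fun a b => exists g, a = g ** inv g /\ b = one)); [|eauto].
  intros a b [f [-> ->]]; split.
  - apply xorb_nilpotent.
  - intro x; rewrite sec_mul, sec_inv, xorb_assoc, xorb_nilpotent, xorb_false_r.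
    eauto.
Qed.

Lemma mulKg g h : inv g ** (g ** h) = h.
Proof. now rewrite <- mulA, mulVg, mul1g. Qed.

Lemma mulVKg g h : g ** (inv g ** h) = h.
Proof. now rewrite <- mulA, mulgV, mul1g. Qed.

Lemma mulg_injl g h k : g ** h = g ** k -> h = k.
Proof. intro H; now rewrite <- (mulKg g h), H, mulKg. Qed.

Lemma mulg_injr g h k : h ** g = k ** g -> h = k.
Proof.
  intro H; rewrite <- (mulg1 h), <- (mulg1 k), <- (mulgV g), <- !mulA.
  now rewrite H.
Qed.

Lemma invMg g h : inv (g ** h) = inv h ** inv g.
Proof.
  apply (mulg_injl (g ** h)); rewrite mulgV, mulA, mulVKg; symmetry.
  apply mulgV.
Qed.

Lemma invgK g : inv (inv g) = g.
Proof. apply (mulg_injl (inv g)); now rewrite mulgV, mulVg. Qed.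

Lemma invg1 : inv one = one.
Proof. apply (mulg_injl one); now rewrite mulgV, mul1g. Qed.

Create HintDb wgrp.
#[local] Hint Rewrite mulA mul1g mulg1 mulVg mulgV mulKg mulVKg invMg invgK invg1
  : wgrp.
Ltac wgrp := autorewrite with wgrp.

Create HintDb wsec.
#[local] Hint Rewrite mul_root sec_mul inv_root sec_inv sec_one sec_sigma
  sec_delta sec_tau sec_vstar1 : wsec.
Ltac wsec := autorewrite with wsec.

Definition conjg (g h : W) : W := inv g ** h ** g.

Lemma conj_mul g h k : conjg g (h ** k) = conjg g h ** conjg g k.
Proof. unfold conjg; now wgrp. Qed.

Lemma conj_inv g h : conjg g (inv h) = inv (conjg g h).
Proof. unfold conjg; now wgrp. Qed.

Lemma conj_one g : conjg g one = one.
Proof. unfold conjg; now wgrp. Qed.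

Lemma conj_conj g h k : conjg g (conjg h k) = conjg (h ** g) k.
Proof. unfold conjg; now wgrp. Qed.

Lemma conj1 k : conjg one k = k.
Proof. unfold conjg; now wgrp. Qed.

Lemma conj_comm g h : g ** h = h ** g -> conjg g h = h.
Proof. intro H; unfold conjg; rewrite mulA, <- H; now wgrp. Qed.

Lemma conj_fix g h : conjg g h = h -> g ** h = h ** g.
Proof. intro H; rewrite <- H at 1; unfold conjg; now wgrp. Qed.

(** Conjugation moves the supporting subtree to its image under [g], and only the section of [g] at
    [x] sees it. This is what lets arguments descend to sections. *)
Lemma conj_vstar1 g x k :
  conjg g (vstar [x] k) = vstar [xorb x (g [])] (conjg (sec g x) k).
Proof.
  unfold conjg; apply W_ext.
  - wsec; simpl; now destruct (g []).
  - intro y; wsec; simpl.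
    destruct x, y, (g []); simpl; wgrp; reflexivity.
Qed.

Lemma vstar1_mul x g h : vstar [x] (g ** h) = vstar [x] g ** vstar [x] h.
Proof.
  apply W_ext; [reflexivity|intro y; wsec; simpl].
  destruct x, y; simpl; wgrp; reflexivity.
Qed.

Lemma vstar1_inv x g : vstar [x] (inv g) = inv (vstar [x] g).
Proof.
  apply W_ext; [reflexivity|intro y; wsec; simpl].
  destruct x, y; simpl; wgrp; reflexivity.
Qed.

Lemma vstar1_one x : vstar [x] one = one.
Proof.
  apply W_ext; [reflexivity|intro y; wsec].
  destruct x, y; reflexivity.
Qed.

Lemma delta_delta : delta ** delta = one.
Proof.
  apply (bisim (fun a b => a = delta ** delta /\ b = one)); [|auto].
  intros a b [-> ->]; split; [reflexivity|intro y; wsec; auto].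
Qed.

Lemma inv_delta : inv delta = delta.
Proof. apply (mulg_injl delta); now rewrite mulgV, delta_delta. Qed.

Lemma decomp g :
  g = vstar [false] (sec g false) ** vstar [true] (sec g true)
      ** (if g [] then sigma else one).
Proof.
  apply W_ext.
  - wsec; simpl; now destruct (g []).
  - intro x; wsec; simpl; destruct x, (g []); wsec; simpl; wgrp; reflexivity.
Qed.

(** * Subgroups and normalizers *)

Definition subgroup (H : W -> Prop) : Prop :=
  H one /\ (forall g h, H g -> H h -> H (g ** h)) /\ (forall g, H g -> H (inv g)).

Lemma subgroup_gen S : subgroup (gen S).
Proof. split; [apply gen_one|split; [apply gen_mul|apply gen_inv]]. Qed.

Lemma gen_min (S H : W -> Prop) :
  subgroup H -> (forall g, S g -> H g) -> forall g, gen S g -> H g.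
Proof. intros [H1 [Hm Hv]] HS g; induction 1; auto. Qed.

Lemma subgroup_mulr H g h : subgroup H -> H h -> (H (g ** h) <-> H g).
Proof.
  intros [H1 [Hm Hv]] Hh; split; intro Hg; [|auto].
  replace g with (g ** h ** inv h) by (now wgrp); auto.
Qed.

Lemma subgroup_mull H g h : subgroup H -> H g -> (H (g ** h) <-> H h).
Proof.
  intros [H1 [Hm Hv]] Hg; split; intro Hh; [|auto].
  rewrite <- (mulKg g h); auto.
Qed.

Lemma subgroup_inv H g : subgroup H -> (H (inv g) <-> H g).
Proof.
  intros [H1 [Hm Hv]]; split; intro Hh; [|auto].
  rewrite <- (invgK g); auto.
Qed.

Lemma subgroup_comap H g : subgroup H -> subgroup (fun h => H (conjg g h)).
Proof.
  intros [H1 [Hm Hv]]; split; [|split].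
  - now rewrite conj_one.
  - intros a b; rewrite conj_mul; auto.
  - intros a; rewrite conj_inv; auto.
Qed.

Lemma subgroup_normalizer H : subgroup (normalizer H).
Proof.
  unfold normalizer; split; [|split].
  - intro h; fold (conjg one h); now rewrite conj1.
  - intros g k Hg Hk h; fold (conjg (g ** k) h); rewrite <- conj_conj.
    rewrite (Hg h); apply Hk.
  - intros g Hg h; rewrite (Hg (inv (inv g) ** _ ** _)).
    replace (inv g ** _ ** g) with h by (now wgrp); reflexivity.
Qed.

Lemma normalizer_incl H g : subgroup H -> H g -> normalizer H g.
Proof.
  intros HS Hg h; rewrite subgroup_mulr, subgroup_mull; auto; [reflexivity|].
  now apply subgroup_inv.
Qed.

(** * Integer powers of [tau] and the structure of [G] *)

(** The portrait of the power [tau^k]. Floor division covers negative [k], and for odd [k] the carry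
    goes to the branch [1] because [tau = (1, tau) sigma]. *)
Fixpoint tz (k : Z) (v : list bool) : bool :=
  match v with
  | [] => Z.odd k
  | a :: w => tz (k / 2 + (if Z.odd k && a then 1 else 0)) w
  end.

Lemma sec_tz k a : sec (tz k) a = tz (k / 2 + (if Z.odd k && a then 1 else 0)).
Proof. reflexivity. Qed.

Lemma tz_root k : tz k [] = Z.odd k.
Proof. reflexivity. Qed.

Lemma Zodd_half k : (k = 2 * (k / 2) + (if Z.odd k then 1 else 0))%Z.
Proof. rewrite <- Z.div2_div; apply Z.div2_odd. Qed.

Lemma tz_mul j k : tz j ** tz k = tz (j + k).
Proof.
  apply (bisim (fun a b => exists j k, a = tz j ** tz k /\ b = tz (j + k)%Z));
    [|eauto].
  clear j k; intros a b (j & k & -> & ->); split.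
  - cbn [tz]; rewrite mul_root, !tz_root, Z.odd_add; reflexivity.
  - intro x; rewrite sec_mul, !sec_tz, tz_root.
    do 2 eexists; split; [reflexivity|]; f_equal.
    pose proof (Zodd_half j); pose proof (Zodd_half k).
    pose proof (Zodd_half (j + k)); rewrite Z.odd_add in *.
    destruct (Z.odd j), (Z.odd k), x; cbn [xorb andb] in *; lia.
Qed.

Lemma tz0 : tz 0 = one.
Proof. apply (mulg_injl (tz 0)); now rewrite tz_mul, mulg1. Qed.

Lemma tz1 : tz 1 = tau.
Proof.
  apply (bisim (fun a b => (a = tz 1 /\ b = tau) \/ a = b)); [|auto].
  intros a b [[-> ->]| ->]; [|auto].
  split; [reflexivity|intros []; rewrite sec_tz, sec_tau].
  - auto.
  - right; exact tz0.
Qed.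

Lemma tz_inv k : inv (tz k) = tz (- k).
Proof.
  apply (mulg_injl (tz k)); rewrite mulgV, tz_mul.
  now replace (k + - k)%Z with 0%Z by lia; rewrite tz0.
Qed.

(** The root labels give equal parities, and the sections at [0] then halve the difference of the
    exponents; the induction is on a bound for that difference. *)
Lemma tz_inj j k : tz j = tz k -> j = k.
Proof.
  enough (H : forall n j k, (Z.abs (j - k) <= Z.of_nat n)%Z ->
                tz j = tz k -> j = k)
    by exact (H (Z.to_nat (Z.abs (j - k))) j k ltac:(lia)).
  clear; induction n as [|n IH]; intros j k Hn H; [lia|].
  pose proof (equal_f H []) as H0; rewrite !tz_root in H0.
  assert (H1 : sec (tz j) false = sec (tz k) false) by now rewrite H.
  rewrite !sec_tz, !andb_false_r in H1.
  pose proof (Zodd_half j); pose proof (Zodd_half k); rewrite H0 in *.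
  apply IH in H1; lia.
Qed.

(* All sections of [g] at level [n] are powers of [tau], with exponents of
   total sum [k]. *)
Fixpoint tau_sum (n : nat) (g : W) (k : Z) : Prop :=
  match n with
  | O => g = tz k
  | S n => exists a b,
      tau_sum n (sec g false) a /\ tau_sum n (sec g true) b /\ k = (a + b)%Z
  end.

Lemma tau_sum_mul n g h j k :
  tau_sum n g j -> tau_sum n h k -> tau_sum n (g ** h) (j + k).
Proof.
  revert g h j k; induction n as [|n IH]; cbn [tau_sum]; intros g h j k.
  - intros -> ->; apply tz_mul.
  - intros (a & b & Ha & Hb & ->) (c & d & Hc & Hd & ->).
    rewrite !sec_mul; destruct (g []); simpl.
    + exists (a + d)%Z, (b + c)%Z; repeat split; auto; lia.
    + exists (a + c)%Z, (b + d)%Z; repeat split; auto; lia.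
Qed.

Lemma tau_sum_inv n g k : tau_sum n g k -> tau_sum n (inv g) (- k).
Proof.
  revert g k; induction n as [|n IH]; cbn [tau_sum]; intros g k.
  - intros ->; apply tz_inv.
  - intros (a & b & Ha & Hb & ->).
    rewrite !sec_inv; destruct (g []); simpl.
    + exists (- b)%Z, (- a)%Z; repeat split; auto; lia.
    + exists (- a)%Z, (- b)%Z; repeat split; auto; lia.
Qed.

(** The two sections of [tau^k] have exponents adding up to [k], so passing to a deeper level leaves
    the sum unchanged. *)
Lemma tau_sum_tz n k : tau_sum n (tz k) k.
Proof.
  revert k; induction n as [|n IH]; intro k; [reflexivity|].
  cbn [tau_sum]; rewrite !sec_tz; do 2 eexists; repeat split; [apply IH..|].
  pose proof (Zodd_half k); destruct (Z.odd k); cbn [andb] in *; lia.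
Qed.

Lemma tau_sum_le n m g k : n <= m -> tau_sum n g k -> tau_sum m g k.
Proof.
  revert m g k; induction n as [|n IH]; intros m g k Hm H.
  - rewrite H; apply tau_sum_tz.
  - destruct m as [|m]; [lia|].
    destruct H as (a & b & Ha & Hb & ->); exists a, b.
    repeat split; apply IH; auto; lia.
Qed.

Lemma tau_sum_fun n g j k : tau_sum n g j -> tau_sum n g k -> j = k.
Proof.
  revert g j k; induction n as [|n IH]; cbn [tau_sum]; intros g j k.
  - intros -> H; now apply tz_inj.
  - intros (a & b & Ha & Hb & ->) (c & d & Hc & Hd & ->).
    f_equal; eauto.
Qed.

Definition has_sum (g : W) (k : Z) : Prop := exists n, tau_sum n g k.

Lemma has_sum_mul g h j k :
  has_sum g j -> has_sum h k -> has_sum (g ** h) (j + k).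
Proof.
  intros [n Hn] [m Hm]; exists (max n m).
  apply tau_sum_mul; (eapply tau_sum_le; [|eassumption]; lia).
Qed.

Lemma has_sum_inv g k : has_sum g k -> has_sum (inv g) (- k).
Proof. intros [n Hn]; exists n; now apply tau_sum_inv. Qed.

Lemma has_sum_fun g j k : has_sum g j -> has_sum g k -> j = k.
Proof.
  intros [n Hn] [m Hm]; apply (tau_sum_fun (max n m) g);
    (eapply tau_sum_le; [|eassumption]; lia).
Qed.

Lemma has_sum_tz k : has_sum (tz k) k.
Proof. now exists 0. Qed.

Lemma has_sum_one : has_sum one 0.
Proof. rewrite <- tz0; apply has_sum_tz. Qed.

Lemma has_sum_tau : has_sum tau 1.
Proof. rewrite <- tz1; apply has_sum_tz. Qed.

Lemma has_sum_node g a b :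
  has_sum (sec g false) a -> has_sum (sec g true) b -> has_sum g (a + b).
Proof.
  intros [n Hn] [m Hm]; exists (S (max n m)), a, b; repeat split;
    (eapply tau_sum_le; [|eassumption]; lia).
Qed.

Lemma has_sum_sec g k x : has_sum g k -> exists a, has_sum (sec g x) a.
Proof.
  intros [n Hn]; apply (tau_sum_le n (S n)) in Hn; [|lia].
  destruct Hn as (a & b & Ha & Hb & _); destruct x; [exists b|exists a];
    now exists n.
Qed.

Lemma has_sum_sigma : has_sum sigma 0.
Proof. apply (has_sum_node sigma 0 0); rewrite sec_sigma; apply has_sum_one. Qed.

Lemma has_sum_vstar1 x g k : has_sum g k -> has_sum (vstar [x] g) k.
Proof.
  intro H; destruct x.
  - apply (has_sum_node _ 0 k); rewrite sec_vstar1; simpl; auto.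
    apply has_sum_one.
  - replace k with (k + 0)%Z by lia.
    apply has_sum_node; rewrite sec_vstar1; simpl; auto.
    apply has_sum_one.
Qed.

Lemma has_sum_vstar v g k : has_sum g k -> has_sum (vstar v g) k.
Proof.
  induction v as [|x v IH]; intro H; [exact H|].
  rewrite vstar_cons; apply has_sum_vstar1; auto.
Qed.

(** * Membership in [G] through exponent sums *)

Lemma subgroup_G : subgroup G.
Proof. apply subgroup_gen. Qed.

Lemma Fin_vstar v : Fin (vstar v sigma).
Proof. apply gen_base; eauto. Qed.

Lemma G_vstar_sigma v : G (vstar v sigma).
Proof. apply gen_base; left; apply Fin_vstar. Qed.

Lemma G_sigma : G sigma.
Proof. apply (G_vstar_sigma []). Qed.

Lemma G_tau : G tau.
Proof. apply gen_base; auto. Qed.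

Lemma G_mul g h : G g -> G h -> G (g ** h).
Proof. apply gen_mul. Qed.

Lemma G_inv g : G g -> G (inv g).
Proof. apply gen_inv. Qed.

Lemma G_one : G one.
Proof. apply gen_one. Qed.

Lemma G_ind_gen (H : W -> Prop) : subgroup H ->
  (forall v, H (vstar v sigma)) -> H tau -> forall g, G g -> H g.
Proof.
  intros HS Hv Ht; apply gen_min; auto.
  intros g [Hg| ->]; auto.
  revert g Hg; apply gen_min; auto.
  intros g [v ->]; auto.
Qed.

(** Cancelling [sigma] from [tau = (1, tau) sigma] leaves [tau] below the vertex [1]; conjugation by
    [sigma] moves it below [0]. *)
Lemma G_vstar1_tau x : G (vstar [x] tau).
Proof.
  assert (Ht : G (vstar [true] tau)).
  { replace (vstar [true] tau) with (tau ** sigma).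
    - apply G_mul; [apply G_tau|apply G_sigma].
    - apply W_ext; [reflexivity|intros []; wsec; simpl; wgrp; reflexivity]. }
  destruct x; [exact Ht|].
  replace (vstar [false] tau) with (conjg sigma (vstar [true] tau)).
  - unfold conjg; auto using G_mul, G_inv, G_sigma.
  - rewrite conj_vstar1, sec_sigma, conj1; reflexivity.
Qed.

Lemma G_vstar1 x g : G g -> G (vstar [x] g).
Proof.
  revert g; apply G_ind_gen.
  - split; [|split].
    + rewrite vstar1_one; apply G_one.
    + intros; rewrite vstar1_mul; now apply G_mul.
    + intros; rewrite vstar1_inv; now apply G_inv.
  - intro v; rewrite <- vstar_cons; apply G_vstar_sigma.
  - apply G_vstar1_tau.
Qed.

Lemma G_tz k : G (tz k).
Proof.
  induction k using Z.peano_ind.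
  - rewrite tz0; apply G_one.
  - unfold Z.succ; rewrite <- tz_mul, tz1; auto using G_mul, G_tau.
  - unfold Z.pred; change (-1)%Z with (- (1))%Z.
    rewrite <- tz_mul, <- (tz_inv 1), tz1.
    auto using G_mul, G_tau, G_inv.
Qed.

(** The generators have exponent sums, and these are stable under products and inverses. Conversely,
    such a portrait is assembled level by level from powers of [tau], using [vstar] and [sigma]. *)
Lemma G_has_sum g : G g <-> exists k, has_sum g k.
Proof.
  split.
  - revert g; apply G_ind_gen.
    + split; [|split].
      * exists 0%Z; apply has_sum_one.
      * intros g h [j Hj] [k Hk]; eexists; eapply has_sum_mul; eauto.
      * intros g [j Hj]; eexists; eapply has_sum_inv; eauto.
    + intro v; exists 0%Z; apply has_sum_vstar, has_sum_sigma.
    + exists 1%Z; apply has_sum_tau.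
  - intros (k & n & H); revert g k H; induction n as [|n IH]; intros g k H.
    + rewrite H; apply G_tz.
    + destruct H as (a & b & Ha & Hb & _); rewrite (decomp g).
      apply G_mul; [apply G_mul; apply G_vstar1; eauto|].
      destruct (g []); [apply G_sigma|apply G_one].
Qed.

Lemma G_sec g x : G g -> G (sec g x).
Proof.
  intro H; apply G_has_sum in H; destruct H as [k H].
  apply G_has_sum; eapply has_sum_sec; eauto.
Qed.

Lemma G_secs g : G g <-> forall x, G (sec g x).
Proof.
  split; [intros H x; now apply G_sec|].
  intro H; apply G_has_sum.
  destruct (proj1 (G_has_sum _) (H false)) as [a Ha].
  destruct (proj1 (G_has_sum _) (H true)) as [b Hb].
  eexists; eapply has_sum_node; eauto.
Qed.

Lemma G_vstar1_iff x g : G (vstar [x] g) <-> G g.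
Proof.
  split; [|apply G_vstar1].
  intro H; apply (G_sec _ x) in H; rewrite sec_vstar1 in H.
  now destruct x.
Qed.

(** * Countability and level transitivity of [G] *)

Definition node (b : bool) (g0 g1 : W) : W :=
  fun v => match v with
           | [] => b
           | x :: w => if x then g1 w else g0 w
           end.

Lemma sec_node b g0 g1 x : sec (node b g0 g1) x = if x then g1 else g0.
Proof. now destruct x. Qed.

(** A code at an inner vertex packs the root label with the codes of both sections; at level [0] it
    packs an exponent as a difference of two naturals. *)
Fixpoint enum_tau_sum (n m : nat) : W :=
  match n with
  | O => let (p, q) := of_nat m in tz (Z.of_nat p - Z.of_nat q)
  | S n => let (b, m') := of_nat m in let (p, q) := of_nat m' in
           node (Nat.eqb b 1) (enum_tau_sum n p) (enum_tau_sum n q)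
  end.

Lemma countable_G : countable_set G.
Proof.
  exists (fun m => let (n, p) := of_nat m in enum_tau_sum n p).
  enough (H : forall n g k, tau_sum n g k -> exists m, enum_tau_sum n m = g).
  { intros g Hg; apply G_has_sum in Hg; destruct Hg as (k & n & Hg).
    destruct (H _ _ _ Hg) as [m Hm].
    exists (to_nat (n, m)); now rewrite cancel_of_to. }
  induction n as [|n IH]; intros g k Hg.
  - exists (to_nat (Z.to_nat k, Z.to_nat (- k))); cbn [enum_tau_sum].
    rewrite cancel_of_to, Hg; f_equal; lia.
  - destruct Hg as (a & b & Ha & Hb & _).
    destruct (IH _ _ Ha) as [p Hp], (IH _ _ Hb) as [q Hq].
    exists (to_nat (if g [] then 1 else 0, to_nat (p, q))); cbn [enum_tau_sum].
    rewrite !cancel_of_to, Hp, Hq.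
    apply W_ext; [simpl; now destruct (g [])|intros []; reflexivity].
Qed.

Lemma layered_G : layered G.
Proof.
  split; [|intros x g; apply G_vstar1].
  induction u as [|a u IH]; intros [|b v] Huv; try discriminate Huv.
  - exists one; split; [apply G_one|reflexivity].
  - destruct (IH v) as (g & Hg & Hact); [simpl in Huv; lia|].
    (* With [g] as both sections, the choice works whichever first letter [a] is. *)
    exists (node (xorb a b) g g); split.
    + apply G_secs; intros []; exact Hg.
    + cbn [act]; rewrite sec_node; f_equal; [now destruct a, b|].
        now destruct a.
Qed.

(** * The abelianization of [G] *)

Fixpoint level_parity (n : nat) (g : W) : bool :=
  match n with
  | O => g []
  | S n => xorb (level_parity n (sec g false)) (level_parity n (sec g true))
  end.

Lemma level_parity_mul n g h :
  level_parity n (g ** h) = xorb (level_parity n g) (level_parity n h).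
Proof.
  revert g h; induction n as [|n IH]; intros g h; [reflexivity|].
  cbn [level_parity]; rewrite !sec_mul, !IH; destruct (g []); simpl;
    repeat match goal with |- context [level_parity n ?a] =>
      destruct (level_parity n a) end; reflexivity.
Qed.

Lemma level_parity_one n : level_parity n one = false.
Proof. induction n as [|n IH]; [reflexivity|]; simpl; now rewrite !sec_one, IH. Qed.

Lemma level_parity_inv n g : level_parity n (inv g) = level_parity n g.
Proof.
  pose proof (level_parity_mul n g (inv g)) as H.
  rewrite mulgV, level_parity_one in H; symmetry in H.
  now apply xorb_eq in H.
Qed.

Lemma level_parity_tz n k : level_parity n (tz k) = Z.odd k.
Proof.
  revert k; induction n as [|n IH]; intro k; [reflexivity|].
  cbn [level_parity]; rewrite !sec_tz, !IH, <- Z.odd_add.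
  pose proof (Zodd_half k); destruct (Z.odd k) eqn:Hk; cbn [andb] in *.
  - replace (_ + _)%Z with k by lia; exact Hk.
  - replace (_ + _)%Z with k by lia; exact Hk.
Qed.

(** From the level on which the sections are powers of [tau], every parity equals that of the
    exponent sum. Hence the parities, once corrected by the latter, are finitely supported. *)
Lemma level_parity_tau_sum n m g k :
  n <= m -> tau_sum n g k -> level_parity m g = Z.odd k.
Proof.
  revert m g k; induction n as [|n IH]; intros m g k Hm H.
  - rewrite H; apply level_parity_tz.
  - destruct m as [|m]; [lia|]; destruct H as (a & b & Ha & Hb & ->).
    simpl; rewrite Z.odd_add, (IH m _ a), (IH m _ b); auto; lia.
Qed.

Lemma level_parity_vstar0 n m :
  level_parity m (vstar (repeat false n) sigma) = Nat.eqb n m.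
Proof.
  revert m; induction n as [|n IH]; intro m.
  - destruct m; [reflexivity|]; simpl.
    now rewrite vstar_nil, !sec_sigma, level_parity_one.
  - cbn [repeat]; rewrite vstar_cons; destruct m as [|m]; [reflexivity|].
    cbn [level_parity]; rewrite !sec_vstar1; simpl.
    rewrite IH, level_parity_one; now destruct (Nat.eqb n m).
Qed.

Lemma derived_vstar1 x g : derived G g -> derived G (vstar [x] g).
Proof.
  revert g; apply gen_min.
  - split; [|split].
    + rewrite vstar1_one; apply gen_one.
    + intros; rewrite vstar1_mul; now apply gen_mul.
    + intros; rewrite vstar1_inv; now apply gen_inv.
  - intros g (a & b & Ha & Hb & ->); apply gen_base.
    exists (vstar [x] a), (vstar [x] b); repeat split; try now apply G_vstar1.
    unfold comm; now rewrite !vstar1_mul, !vstar1_inv.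
Qed.

(* Modulo [G'] the section at [1] can be moved to [0] by conjugating with
   [sigma], so [(g0, g1)] is congruent to [0 * (g0 g1)]. *)
Lemma derived_of_invariants g :
  has_sum g 0 -> (forall n, level_parity n g = false) -> derived G g.
Proof.
  intros [n Hn]; revert g Hn; induction n as [|n IH]; intros g Hn Hp.
  - rewrite Hn, tz0; apply gen_one.
  - assert (Hg : forall x, G (sec g x))
      by (intro x; apply G_sec, G_has_sum; now exists 0%Z, (S n)).
    destruct Hn as (a & b & Ha & Hb & Hab).
    pose proof (decomp g) as D0; pose proof (Hp 0) as Hr; simpl in Hr.
    rewrite Hr, mulg1 in D0.
    replace g with (vstar [false] (sec g false ** sec g true)
                      ** comm (vstar [false] (sec g true)) sigma).
    + apply gen_mul.
      * apply derived_vstar1, IH.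
        -- rewrite Hab; now apply tau_sum_mul.
        -- intro m; rewrite level_parity_mul; exact (Hp (S m)).
      * apply gen_base; do 2 eexists; split; [|split; [|reflexivity]].
        -- apply G_vstar1, Hg.
        -- apply G_sigma.
    + rewrite D0 at 4; unfold comm.
      replace (vstar [true] (sec g true))
        with (conjg sigma (vstar [false] (sec g true)))
        by (rewrite conj_vstar1, sec_sigma, conj1; reflexivity).
      unfold conjg; rewrite vstar1_mul; now wgrp.
Qed.

Lemma invariants_of_derived g :
  derived G g -> has_sum g 0 /\ forall n, level_parity n g = false.
Proof.
  revert g; apply gen_min.
  - split; [|split].
    + split; [apply has_sum_one|intro; apply level_parity_one].
    + intros g h [Hg Pg] [Hh Ph]; split; [exact (has_sum_mul _ _ _ _ Hg Hh)|].
      intro; now rewrite level_parity_mul, Pg, Ph.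
    + intros g [Hg Pg]; split; [exact (has_sum_inv _ _ Hg)|].
      intro; now rewrite level_parity_inv.
  - intros g (a & b & Ha & Hb & ->).
    apply G_has_sum in Ha, Hb; destruct Ha as [j Ha], Hb as [k Hb].
    unfold comm; split.
    + replace 0%Z with ((- j + - k) + (j + k))%Z by lia.
      auto using has_sum_mul, has_sum_inv.
    + intro n; rewrite !level_parity_mul, !level_parity_inv.
      now destruct (level_parity n a), (level_parity n b).
Qed.

Lemma realize_parities N s :
  (forall n, N <= n -> s n = false) ->
  exists g, has_sum g 0 /\ forall n, level_parity n g = s n.
Proof.
  revert s; induction N as [|N IH]; intros s Hs.
  - exists one; split; [apply has_sum_one|].
    intro n; rewrite level_parity_one, Hs; auto with arith.
  (* The last entry that may be nonzero is cleared here and restored by [sigma] placed at the vertex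
     [0^N], which changes the parity of level [N] only. *)
  - destruct (IH (fun n => if Nat.eqb N n then false else s n))
      as (g & Hg & Pg).
    { intros n Hn; destruct (Nat.eqb_spec N n); auto; apply Hs; lia. }
    exists (g ** if s N then vstar (repeat false N) sigma else one); split.
    + apply (has_sum_mul g _ 0 0); auto.
      destruct (s N); [apply has_sum_vstar, has_sum_sigma|apply has_sum_one].
    + intro n; rewrite level_parity_mul, Pg.
      destruct (s N) eqn:HN; rewrite ?level_parity_vstar0, ?level_parity_one;
        destruct (Nat.eqb_spec N n); subst; auto using xorb_false_r.
Qed.

Lemma abelianization_G : abelianization_is_Z_plus_Z2inf G.
Proof.
  (* The exponent sum as a total function; its value outside [G] is arbitrary. *)
  pose (e := fun g => epsilon (inhabits 0%Z) (has_sum g)).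
  assert (He : forall g, G g -> has_sum g (e g))
    by (intros g Hg; apply epsilon_spec, G_has_sum, Hg).
  assert (Hu : forall g k, has_sum g k -> e g = k).
  { intros g k Hk; apply (has_sum_fun g); auto; apply He, G_has_sum; eauto. }
  (* A power [tau^k] has the parity of [k] on every level; subtracting this constant makes the
     second coordinate finitely supported. *)
  exists (fun g => (e g, fun n => xorb (level_parity n g) (Z.odd (e g)))).
  split; [|split; [|split]].
  - intros g h Hg Hh.
    assert (Hgh : e (g ** h) = (e g + e h)%Z) by auto using has_sum_mul.
    unfold addA; simpl; rewrite Hgh; f_equal.
    apply functional_extensionality; intro n.
    rewrite level_parity_mul, Z.odd_add.
    now destruct (level_parity n g), (level_parity n h), (Z.odd (e g)),
      (Z.odd (e h)).
  - intros g Hg; destruct (He g Hg) as [N HN]; exists N; intros n Hn; simpl.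
    rewrite (level_parity_tau_sum N n g (e g)); auto; apply xorb_nilpotent.
  - intros z s [N HN].
    destruct (realize_parities N s HN) as (g & Hg & Pg).
    assert (Hs : has_sum (tz z ** g) z).
    { pose proof (has_sum_mul _ _ _ _ (has_sum_tz z) Hg) as H.
      now rewrite Z.add_0_r in H. }
    exists (tz z ** g); split; [apply G_has_sum; eauto|].
    rewrite (Hu _ _ Hs); f_equal.
    apply functional_extensionality; intro n.
    rewrite level_parity_mul, level_parity_tz, Pg.
    now destruct (Z.odd z), (s n).
  - intros g Hg; unfold zeroA; split.
    + intro H; injection H as H1 H2.
      apply derived_of_invariants; [rewrite <- H1; auto|].
      intro n; pose proof (equal_f H2 n) as Hn; simpl in Hn.
      rewrite H1 in Hn; simpl in Hn; now rewrite xorb_false_r in Hn.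
    + intro H; destruct (invariants_of_derived g H) as [Hs Hp].
      rewrite (Hu _ _ Hs); f_equal.
      apply functional_extensionality; intro n; now rewrite Hp.
Qed.

(** * The group [T] is the centralizer of [tau] *)

Lemma forallb_map_comp {A B} (p : B -> bool) (f : A -> B) l :
  forallb p (map f l) = forallb (fun a => p (f a)) l.
Proof. induction l as [|a l IH]; [reflexivity|]; simpl; now rewrite IH. Qed.

Lemma half_succ2 x : half (succ2 x) = if x 0 then succ2 (half x) else half x.
Proof.
  apply functional_extensionality; intro i; unfold half, succ2.
  cbn [seq forallb]; rewrite <- seq_shift, forallb_map_comp.
  destruct (x 0); [reflexivity|apply xorb_false_r].
Qed.

Lemma succ2_0 x : succ2 x 0 = negb (x 0).
Proof. unfold succ2; simpl; now destruct (x 0). Qed.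

Lemma sec_tpow x a :
  sec (tpow x) a = tpow (if x 0 && a then succ2 (half x) else half x).
Proof. reflexivity. Qed.

Lemma tpow_root x : tpow x [] = x 0.
Proof. reflexivity. Qed.

Lemma tpow_mul_tau x : tpow x ** tau = tpow (succ2 x).
Proof.
  (* Exactly one of the two sections picks up a factor [tau]; on the other the sides already agree,
     hence the diagonal in the relation. *)
  apply (bisim (fun a b => (exists x, a = tpow x ** tau /\ b = tpow (succ2 x))
                           \/ a = b)); [|eauto].
  clear x; intros a b [(x & -> & ->)| ->]; [split|auto].
  - rewrite mul_root, !tpow_root, succ2_0; now destruct (x 0).
  - intro y; rewrite sec_mul, sec_tau, !sec_tpow, tpow_root, succ2_0, half_succ2.
    destruct (x 0), y; simpl; rewrite ?mulg1; eauto.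
Qed.

Lemma tau_mul_tpow x : tau ** tpow x = tpow (succ2 x).
Proof.
  apply (bisim (fun a b => (exists x, a = tau ** tpow x /\ b = tpow (succ2 x))
                           \/ a = b)); [|eauto].
  clear x; intros a b [(x & -> & ->)| ->]; [split|auto].
  - rewrite mul_root, !tpow_root, succ2_0; now destruct (x 0).
  - intro y; rewrite sec_mul, sec_tau, !sec_tpow, succ2_0, half_succ2.
    destruct (x 0), y; simpl; rewrite ?mul1g; eauto.
Qed.

Definition centralizes_tau (g : W) : Prop := g ** tau = tau ** g.

(* [g] is either [(a, a)] or [(a, a tau) sigma] with [a] centralizing [tau]. *)
Lemma centralizes_tau_sec g : centralizes_tau g ->
  centralizes_tau (sec g false) /\
  sec g true = sec g false ** (if g [] then tau else one).
Proof.
  unfold centralizes_tau; intro H.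
  assert (H0 : sec (g ** tau) false = sec (tau ** g) false) by now rewrite H.
  assert (H1 : sec (g ** tau) true = sec (tau ** g) true) by now rewrite H.
  revert H0 H1; rewrite !sec_mul, !sec_tau.
  change (tau []) with true; destruct (g []); simpl; wgrp; intros H0 H1.
  - rewrite <- H0 in H1; auto.
  - rewrite <- H0 in H1; auto.
Qed.

Lemma centralizes_tau_secs g x : centralizes_tau g -> centralizes_tau (sec g x).
Proof.
  intro H; destruct (centralizes_tau_sec g H) as [H0 H1].
  destruct x; [|exact H0]; rewrite H1; unfold centralizes_tau in *.
  destruct (g []); wgrp; [|exact H0].
  now rewrite <- (mulA tau), <- H0, mulA.
Qed.

Lemma act_zeros g i :
  act g (repeat false i) = map (fun j => g (repeat false j)) (seq 0 i).
Proof.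
  revert g; induction i as [|i IH]; intro g; [reflexivity|].
  cbn [repeat act seq map]; rewrite IH, <- seq_shift, map_map.
  now destruct (g []).
Qed.

(** The section of [tau^x] at [0] is [tau] to the power [half x], so the bits of the exponent are
    read off along the ray of zeros. *)
Lemma centralizes_tau_tpow g :
  centralizes_tau g -> g = tpow (fun i => g (repeat false i)).
Proof.
  intro H.
  apply (bisim (fun a b => centralizes_tau a /\
           b = tpow (fun i => a (repeat false i)))); [clear g H|auto].
  intros g b [H ->]; split; [reflexivity|intro x].
  split; [now apply centralizes_tau_secs|].
  rewrite sec_tpow; change (repeat false 0) with (@nil bool).
  destruct (centralizes_tau_sec g H) as [_ H1].
  destruct x; [rewrite H1|now rewrite andb_false_r].
  destruct (g []); simpl; [|now rewrite mulg1].
  (* The image of [0^i] under the section lists the lower bits of its exponent, and [tau] is active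
     there exactly when all of them are [1]: this is the carry in [succ2]. *)
  f_equal; apply functional_extensionality; intro i.
  unfold succ2, mul, half; f_equal.
  rewrite act_zeros; unfold tau; now rewrite forallb_map_comp.
Qed.

Lemma T_centralizer g : T g <-> centralizes_tau g.
Proof.
  split.
  - intros [x ->]; unfold centralizes_tau.
    now rewrite tpow_mul_tau, tau_mul_tpow.
  - intro H; eexists; now apply centralizes_tau_tpow.
Qed.

Lemma subgroup_T : subgroup T.
Proof.
  split; [|split]; intros *; rewrite !T_centralizer; unfold centralizes_tau.
  - now wgrp.
  - intros Hg Hh; now rewrite mulA, Hh, <- mulA, Hg, mulA.
  - intro H; apply (mulg_injl g); rewrite mulVKg, <- mulA, H; now wgrp.
Qed.

Lemma T_tau : T tau.
Proof. now apply T_centralizer. Qed.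

Lemma T_sec g x : T g -> T (sec g x).
Proof. rewrite !T_centralizer; apply centralizes_tau_secs. Qed.

Lemma T_sec_true g :
  T g -> sec g true = sec g false ** (if g [] then tau else one).
Proof. intro H; now apply centralizes_tau_sec, T_centralizer. Qed.

(** For [t = tau^x] this is [tau^(2x)]. *)
Lemma T_diag t : T t -> T (node false t t).
Proof.
  rewrite !T_centralizer; unfold centralizes_tau; intro H.
  apply W_ext; [reflexivity|].
  intro x; rewrite !sec_mul, !sec_tau, !sec_node.
  destruct x; simpl; [exact H|now wgrp].
Qed.

Lemma T_comm s t : T s -> T t -> s ** t = t ** s.
Proof.
  intros Hs Ht.
  (* The trailing factor [u] absorbs the copies of [tau] that appear in the sections at [1] of odd
     elements. *)
  apply (bisim (fun a b => exists s t u,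
           T s /\ T t /\ a = s ** t ** u /\ b = t ** s ** u));
    [|exists s, t, one; wgrp; auto].
  clear s t Hs Ht; intros a b (s & t & u & Hs & Ht & -> & ->); split.
  - rewrite !mul_root; f_equal; apply xorb_comm.
  - intro x; rewrite !sec_mul, !mul_root.
    rewrite (xorb_comm (t []) (s [])).
    generalize (sec u (xorb x (xorb (s []) (t [])))); intro u'.
    assert (Es := T_sec_true s Hs); assert (Et := T_sec_true t Ht).
    apply (T_sec _ false) in Hs, Ht.
    assert (Cs := proj1 (T_centralizer _) Hs).
    assert (Ct := proj1 (T_centralizer _) Ht).
    unfold centralizes_tau in *.
    assert (Cs' : forall k, tau ** (sec s false ** k) = sec s false ** (tau ** k))
      by (intro; now rewrite <- mulA, <- Cs, mulA).
    assert (Ct' : forall k, tau ** (sec t false ** k) = sec t false ** (tau ** k))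
      by (intro; now rewrite <- mulA, <- Ct, mulA).
    exists (sec s false), (sec t false).
    destruct x, (s []), (t []); simpl; rewrite ?Es, ?Et; wgrp;
      rewrite ?Cs', ?Ct', <- ?Cs, <- ?Ct;
      (eexists; split; [auto|split; [auto|split; rewrite !mulA; reflexivity]]).
Qed.

(** * The normalizer of [G] *)

Lemma normalizer_conj H g h : normalizer H g -> (H (conjg g h) <-> H h).
Proof. intro Hg; symmetry; apply Hg. Qed.

Lemma normalizer_G_intro g :
  (forall v, G (conjg g (vstar v sigma))) -> G (conjg g tau) ->
  (forall v, G (conjg (inv g) (vstar v sigma))) -> G (conjg (inv g) tau) ->
  normalizer G g.
Proof.
  intros Hs Ht Hs' Ht' h; split; intro Hh.
  - revert h Hh; apply G_ind_gen; auto.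
    apply (subgroup_comap G g), subgroup_G.
  - replace h with (conjg (inv g) (inv g ** h ** g)) by (unfold conjg; now wgrp).
    revert Hh; generalize (inv g ** h ** g); apply G_ind_gen; auto.
    apply subgroup_comap, subgroup_G.
Qed.

(** Stated for any [H] meeting the elements supported below one letter in a copy of [G], so that it
    serves both [G] and its normalizer. *)
Lemma normalizer_sec H g x :
  (forall y k, H (vstar [y] k) <-> G k) -> normalizer H g ->
  normalizer G (sec g x).
Proof.
  intros HG Hg k; fold (conjg (sec g x) k).
  rewrite <- (HG x k), <- (HG (xorb x (g [])) (conjg _ _)), <- conj_vstar1.
  now rewrite (normalizer_conj H g).
Qed.

(** The two sections of [t] differ by [1] or [tau], so in the conjugate of [sigma] they cancel up to
    a factor [tau] or its inverse. *)
Lemma T_conj_sigma t v : T t -> G (conjg t (vstar v sigma)).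
Proof.
  revert t; induction v as [|x v IH]; intros t Ht.
  - rewrite vstar_nil; apply G_secs; intro x; unfold conjg.
    pose proof (T_sec_true t Ht) as Et.
    wsec; destruct x, (t []); simpl; rewrite Et; wgrp;
      auto using G_one, G_tau, G_inv.
  - rewrite vstar_cons, conj_vstar1; apply G_vstar1, IH, T_sec, Ht.
Qed.

Lemma T_conj_tau t : T t -> conjg t tau = tau.
Proof. intro Ht; apply conj_comm; now apply T_centralizer. Qed.

Lemma normalizer_T t : T t -> normalizer G t.
Proof.
  intro Ht; assert (Hv : T (inv t)) by now apply subgroup_T.
  apply normalizer_G_intro; rewrite ?T_conj_tau; auto using G_tau, T_conj_sigma.
Qed.

(** Conjugation by [delta] swaps the two sections. Inversion swaps them too if [t] is odd, and if
    [t] is even they coincide. *)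
Lemma delta_conj_T t : T t -> conjg delta t = inv t.
Proof.
  intro Ht.
  apply (bisim (fun a b => exists t, T t /\ a = conjg delta t /\ b = inv t));
    [|eauto].
  clear t Ht; intros a b (t & Ht & -> & ->); split.
  - unfold conjg; wsec; unfold delta; now destruct (t []).
  - intro x; pose proof (T_sec_true t Ht) as Et.
    exists (sec t (negb x)); split; [now apply T_sec|].
    unfold conjg; wsec; split; [destruct x; reflexivity|].
    destruct x, (t []); simpl; rewrite ?Et; wgrp; reflexivity.
Qed.

Lemma delta_conj_sigma v : G (conjg delta (vstar v sigma)).
Proof.
  induction v as [|x v IH].
  - apply G_secs; intro x; rewrite vstar_nil; unfold conjg; wsec; wgrp.
    apply G_one.
  - rewrite vstar_cons, conj_vstar1, sec_delta; now apply G_vstar1.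
Qed.

Lemma normalizer_delta : normalizer G delta.
Proof.
  apply normalizer_G_intro; rewrite ?inv_delta; auto using delta_conj_sigma;
    rewrite delta_conj_T; auto using T_tau, G_inv, G_tau.
Qed.

Lemma normalizer_G_incl g : G g -> normalizer G g.
Proof. apply normalizer_incl, subgroup_G. Qed.

Lemma normalizer_G_mul g h :
  normalizer G g -> normalizer G h -> normalizer G (g ** h).
Proof. apply subgroup_normalizer. Qed.

Lemma normalizer_G_inv g : normalizer G g -> normalizer G (inv g).
Proof. apply subgroup_normalizer. Qed.

Lemma normalizer_G_sec g x : normalizer G g -> normalizer G (sec g x).
Proof. apply normalizer_sec; intros; apply G_vstar1_iff. Qed.

(* The conjugate of [sigma] by [(g0, g1)] has [g0^-1 g1] as a section. *)
Lemma normalizer_G_quotient g :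
  normalizer G g -> G (inv (sec g false) ** sec g true).
Proof.
  intro Hg; pose proof (proj1 (Hg sigma) G_sigma) as H; fold (conjg g sigma) in H.
  apply (G_sec _ (g [])) in H; revert H; unfold conjg; wsec.
  destruct (g []); simpl; now wgrp.
Qed.

Lemma node_mul a b c d :
  node false a b ** node false c d = node false (a ** c) (b ** d).
Proof.
  apply W_ext; [reflexivity|intro x; rewrite sec_mul, !sec_node].
  now destruct x.
Qed.

Lemma G_node b g0 g1 : G g0 -> G g1 -> G (node b g0 g1).
Proof. intros H0 H1; apply G_secs; intro x; rewrite sec_node; now destruct x. Qed.

(** * Deep sections of a normalizing element *)

Fixpoint on_level (n : nat) (P : W -> Prop) (g : W) : Prop :=
  match n with
  | O => P g
  | S n => on_level n P (sec g false) /\ on_level n P (sec g true)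
  end.

Lemma on_level_impl n (P Q : W -> Prop) g :
  (forall u, P u -> Q u) -> on_level n P g -> on_level n Q g.
Proof.
  intro HPQ; revert g; induction n as [|n IH]; simpl; [auto|].
  intros g []; auto.
Qed.

Lemma on_level_delta n P g :
  on_level n (fun u => P (u ** delta)) g -> on_level n P (g ** delta).
Proof.
  revert g; induction n as [|n IH]; simpl; [auto|].
  intros g []; rewrite !sec_mul, !sec_delta; auto.
Qed.

(** The sections of [inv g] on a level are the inverses of those of [g], permuted, so some section
    meets both conditions. *)
Lemma on_level_inv n (P Q : W -> Prop) g :
  on_level n P g -> on_level n Q (inv g) -> exists u, P u /\ Q (inv u).
Proof.
  revert g; induction n as [|n IH]; simpl; [eauto|].
  intros g [H0 H1] [H0' H1']; rewrite sec_inv in H0', H1'.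
  apply (IH (sec g false)); [exact H0|].
  destruct (g []); [exact H1'|exact H0'].
Qed.

Lemma conj_tz g e k : conjg g tau = tz e -> conjg g (tz k) = tz (e * k).
Proof.
  intro H; induction k as [|k IH|k IH] using Z.peano_ind.
  - now rewrite Z.mul_0_r, tz0, conj_one.
  - unfold Z.succ; rewrite <- tz_mul, conj_mul, IH, tz1, H, tz_mul; f_equal; lia.
  - unfold Z.pred; change (-1)%Z with (- (1))%Z.
    rewrite <- tz_mul, <- (tz_inv 1), conj_mul, conj_inv, IH, tz1, H, tz_inv, tz_mul.
    f_equal; lia.
Qed.

(* [tau^2 = (tau, tau)], so the conjugate [h] of [tau] by [g] satisfies
   [h^2 = (tau^g0, tau^g1)] up to order. *)
Lemma conj_tau_sec g x : conjg (sec g x) tau =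
  sec (conjg g tau) (xorb x (g [])) ** sec (conjg g tau) (negb (xorb x (g []))).
Proof.
  unfold conjg; wsec; change (tau []) with true.
  destruct x, (g []); simpl; wgrp; reflexivity.
Qed.

(** Passing to a section of [g] replaces the conjugate of [tau] by the product of its two sections
    in some order, whose exponent sum is again [e]. So the same [e] reaches every vertex of level
    [n]. *)
Lemma conj_tau_level n g e : tau_sum n (conjg g tau) e ->
  on_level n (fun u => conjg u tau = tz e) g.
Proof.
  revert g e; induction n as [|n IH]; intros g e H; [exact H|].
  destruct H as (a & b & Ha & Hb & ->).
  split; apply IH; rewrite conj_tau_sec; destruct (g []); simpl.
  2, 3: now apply tau_sum_mul.
  all: rewrite Z.add_comm; now apply tau_sum_mul.
Qed.

Lemma normalizer_G_tau g : normalizer G g ->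
  exists n e, (e = 1 \/ e = -1)%Z /\ on_level n (fun u => conjg u tau = tz e) g.
Proof.
  intro Hg; pose proof (normalizer_G_inv g Hg) as Hg'.
  pose proof (proj1 (Hg tau) G_tau) as H.
  pose proof (proj1 (Hg' tau) G_tau) as H'.
  apply G_has_sum in H, H'.
  destruct H as (e & n & H), H' as (e' & n' & H').
  apply (tau_sum_le n (max n n')) in H; [|lia].
  apply (tau_sum_le n' (max n n')) in H'; [|lia].
  apply conj_tau_level in H, H'.
  exists (max n n'), e; split; [|exact H].
  destruct (on_level_inv _ _ _ _ H H') as (u & Hu & Hu').
  (* Conjugating by [u] and back returns [tau], so [e' * e = 1] and [e] is a unit. *)
  assert (E : conjg (u ** inv u) tau = tz (e' * e)).
  { rewrite <- conj_conj, Hu; now apply conj_tz. }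
  rewrite mulgV, conj1, <- tz1 in E; apply tz_inj in E.
  assert (Hd : (e | 1)%Z) by (exists e'; exact E).
  now apply Z.divide_1_r in Hd.
Qed.

(* If [g = (t k, t' k')] normalizes [G] then [t] and [t'] differ by an element
   of [G], so [g] agrees with [(t, t)], again in [T], modulo [G]. *)
Lemma normalizer_G_level_T n g : normalizer G g -> on_level n T g ->
  exists t k, T t /\ G k /\ g = t ** k.
Proof.
  revert g; induction n as [|n IH]; intros g Hg H.
  - exists g, one; wgrp; auto using G_one.
  - destruct H as [H0 _].
    destruct (IH (sec g false)) as (t & k & Ht & Hk & E);
      auto using normalizer_G_sec.
    exists (node false t t), (inv (node false t t) ** g); split; [|split].
    + now apply T_diag.
    + pose proof (normalizer_G_quotient g Hg) as Hq; rewrite E in Hq.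
      apply G_secs; intro x; wsec; rewrite sec_node; simpl.
      destruct x; simpl.
      * revert Hq; wgrp; intro Hq.
        apply (G_mul k) in Hq; auto; revert Hq; now wgrp.
      * rewrite E; now wgrp.
    + now wgrp.
Qed.

Lemma normalizer_G_decomp g : normalizer G g ->
  exists t k d, T t /\ G k /\ (d = one \/ d = delta) /\ g = t ** k ** d.
Proof.
  intro Hg; destruct (normalizer_G_tau g Hg) as (n & e & He & Hn).
  assert (H : exists d, (d = one \/ d = delta) /\ on_level n T (g ** d)).
  { destruct He as [-> | ->].
    - exists one; split; [auto|]; rewrite mulg1; revert Hn; apply on_level_impl.
      intros u Hu; rewrite tz1 in Hu.
      apply T_centralizer; now apply conj_fix.
    (* Here the sections invert [tau], and so does [delta]; their products with [delta] centralize
       it. *)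
    - exists delta; split; [auto|]; apply on_level_delta; revert Hn.
      apply on_level_impl; intros u Hu; apply T_centralizer, conj_fix.
      rewrite <- conj_conj, Hu.
      change (-1)%Z with (- (1))%Z.
      rewrite <- tz_inv, tz1, conj_inv, delta_conj_T, invgK; auto using T_tau. }
  destruct H as (d & Hd & H).
  destruct (normalizer_G_level_T n (g ** d)) as (t & k & Ht & Hk & E); auto.
  { apply normalizer_G_mul; auto.
    destruct Hd as [-> | ->];
      [apply normalizer_G_incl, G_one|apply normalizer_delta]. }
  exists t, k, d; repeat split; auto.
  rewrite <- E, mulA; destruct Hd as [-> | ->]; rewrite ?delta_delta; now wgrp.
Qed.

Lemma normalizer_G_iff g : normalizer G g <->
  exists a d, gen (fun h => Fin h \/ T h) a /\ D d /\ g = a ** d.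
Proof.
  split.
  - intro Hg; destruct (normalizer_G_decomp g Hg) as (t & k & d & Ht & Hk & Hd & ->).
    exists (t ** k), d; split; [|split; [|reflexivity]].
    + apply gen_mul; [now apply gen_base; right|].
      clear Hg; revert k Hk; apply G_ind_gen; [apply subgroup_gen| |].
      * intro v; apply gen_base; left; apply Fin_vstar.
      * apply gen_base; right; apply T_tau.
    + destruct Hd as [-> | ->]; [apply gen_one|now apply gen_base].
  - intros (a & d & Ha & Hd & ->); apply normalizer_G_mul.
    + revert a Ha; apply gen_min; [apply subgroup_normalizer|].
      intros h [Hh|Hh]; [|now apply normalizer_T].
      apply normalizer_G_incl, gen_base; auto.
    + revert d Hd; apply gen_min; [apply subgroup_normalizer|].
      intros h ->; apply normalizer_delta.
Qed.

(** * The second normalizer *)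

(** Each factor of the decomposition survives doubling: [(t, t)] lies in [T], [(k, k)] in [G], and
    [(delta, delta)] is [delta ** sigma]. *)
Lemma normalizer_G_diag g : normalizer G g -> normalizer G (node false g g).
Proof.
  intro Hg; destruct (normalizer_G_decomp g Hg) as (t & k & d & Ht & Hk & Hd & ->).
  rewrite <- !node_mul; apply normalizer_G_mul; [apply normalizer_G_mul|].
  - apply normalizer_T, T_diag, Ht.
  - apply normalizer_G_incl, G_node; auto.
  - destruct Hd as [-> | ->].
    + apply normalizer_G_incl, G_node; apply G_one.
    + replace (node false delta delta) with (delta ** sigma).
      * apply normalizer_G_mul; [apply normalizer_delta|].
        apply normalizer_G_incl, G_sigma.
      * apply W_ext; [reflexivity|intro x; wsec; rewrite sec_node].
        destruct x; now wgrp.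
Qed.

(** An odd [t] with first section [a] is excluded, as its square has the section [a a tau], active
    at the root. For even [t] both sections inherit the hypothesis. *)
Lemma T_square_one t : T t -> t ** t = one -> t = one.
Proof.
  intros Ht H.
  apply (bisim (fun a b => (T a /\ a ** a = one) /\ b = one)); [|auto].
  clear t Ht H; intros t b [[Ht H] ->].
  pose proof (T_sec_true t Ht) as Et.
  assert (H0 : sec (t ** t) false = one) by now rewrite H.
  rewrite sec_mul in H0; simpl in H0.
  destruct (t []) eqn:Hr.
  - pose proof (equal_f H0 []) as Hc; rewrite Et in Hc.
    revert Hc; wsec; change (tau []) with true; unfold one.
    now destruct (sec t false []).
  - split; [reflexivity|]; intro x; rewrite sec_one.
    split; [split|reflexivity]; [now apply T_sec|].
    destruct x; rewrite ?Et, ?mulg1; exact H0.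
Qed.

(** If [t^2 = tau^k], then [k] is even and [t] times [tau^(-k/2)] squares to [1], hence is trivial.
    Deeper levels reduce to this by taking sections. *)
Lemma T_square_G t : T t -> G (t ** t) -> G t.
Proof.
  intros Ht H; apply G_has_sum in H; destruct H as (k & n & H).
  revert t k Ht H; induction n as [|n IH]; intros t k Ht H.
  - cbn [tau_sum] in H.
    assert (Hk : Z.odd k = false)
      by (rewrite <- tz_root, <- H, mul_root; apply xorb_nilpotent).
    pose proof (Zodd_half k) as Hh; rewrite Hk in Hh.
    set (j := (k / 2)%Z) in *.
    assert (Hj : forall i, T (tz i))
      by (intro i; apply T_centralizer; unfold centralizes_tau;
          rewrite <- tz1, !tz_mul; f_equal; lia).
    assert (E : t ** tz (- j) = one).
    { apply T_square_one; [now apply subgroup_T|].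
      rewrite mulA, <- (mulA _ t), (T_comm (tz (- j)) t), mulA by auto.
      rewrite tz_mul, <- mulA, H, tz_mul, <- tz0; f_equal; lia. }
    rewrite <- tz_inv in E.
    assert (Et : t = tz j) by (apply (mulg_injr (inv (tz j))); now rewrite mulgV).
    rewrite Et; apply G_tz.
  - destruct H as (a & _ & Ha & _ & _).
    pose proof (T_sec_true t Ht) as Et; rewrite sec_mul in Ha; simpl in Ha.
    assert (H0 : G (sec t false)).
    { destruct (t []).
      (* For odd [t] the section of the square is [a a tau], where [a] is the first section of [t];
         removing [tau] lowers the exponent sum by one. *)
      - rewrite Et in Ha; apply (IH _ (a + - (1))%Z); [now apply T_sec|].
        pose proof (tau_sum_mul n _ _ _ _ Ha (tau_sum_tz n (- (1)))) as H.
        rewrite <- tz_inv, tz1 in H; revert H; now wgrp.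
      - apply (IH _ a); [now apply T_sec|]; exact Ha. }
    apply G_secs; intros []; [|exact H0].
    rewrite Et; apply G_mul; [exact H0|].
    destruct (t []); [apply G_tau|apply G_one].
Qed.

(** A diagonal argument against the enumeration of [G]: along the ray of zeros [tau^x] shows the
    bits of [x], which may be prescribed freely. *)
Lemma T_not_G : exists t, T t /\ ~ G t.
Proof.
  destruct countable_G as [f Hf].
  pose (x := fun n => negb (f n (repeat false n))).
  exists (tpow x); split; [now exists x|intro H].
  destruct (Hf _ H) as [n Hn].
  assert (Hx : forall n x, tpow x (repeat false n) = x n).
  { clear; induction n as [|n IH]; intro x; [reflexivity|].
    cbn [repeat tpow]; rewrite andb_false_r; apply IH. }
  specialize (Hx n x); rewrite <- Hn in Hx; unfold x in Hx.
  now destruct (f n (repeat false n)).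
Qed.

(* Modulo [G], the sections [g0] and [g1] differ by some [q = t d] with [t] in
   [T].  Conjugating [(u, u)] for [u] in [T] outside [G] excludes [d = delta];
   conjugating [sigma] gives [t^2] in [G], hence [t] in [G]. *)
Lemma normalizer_normalizer_G g :
  normalizer (normalizer G) g -> normalizer G g.
Proof.
  intro Hg.
  (* One section is trivial, so the quotient of the two sections is [k] or its inverse. *)
  assert (HN : forall y k, normalizer G (vstar [y] k) <-> G k).
  { intros y k; split; [intro H|intro; apply normalizer_G_incl, G_vstar1; auto].
    apply normalizer_G_quotient in H; rewrite !sec_vstar1 in H.
    destruct y; simpl in H; [now rewrite invg1, mul1g in H|].
    rewrite mulg1 in H; now apply (subgroup_inv G k subgroup_G). }
  assert (Hs : forall x, normalizer G (sec g x))
    by (intro; eapply normalizer_sec; eauto).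
  set (g0 := sec g false) in *; set (g1 := sec g true) in *.
  assert (H0 : normalizer G g0) by apply Hs.
  assert (H1 : normalizer G g1) by apply Hs.
  set (q := g1 ** inv g0).
  assert (Hq : normalizer G q) 
    by (apply normalizer_G_mul, normalizer_G_inv; auto).
  assert (Hqq : G (q ** q)).
  { assert (H : normalizer G (conjg g sigma))
      by (apply (normalizer_conj _ g sigma Hg), normalizer_G_incl, G_sigma).
    apply normalizer_G_quotient in H; revert H; unfold conjg; wsec.
    fold g0 g1; destruct (g []); simpl; fold g0 g1; wgrp; intro H.
    - rewrite <- (normalizer_conj G g0) by auto.
      revert H; unfold conjg, q; now wgrp.
    - rewrite <- (subgroup_inv G _ subgroup_G).
      rewrite <- (normalizer_conj G g0) by auto.
      revert H; unfold conjg, q; now wgrp. }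
  assert (Hu : forall u, T u -> G (inv u ** conjg q u)).
  { intros u Hu.
    assert (H : normalizer G (conjg g (node false u u)))
      by (apply (normalizer_conj _ g _ Hg), normalizer_T, T_diag, Hu).
    apply normalizer_G_quotient in H; revert H; unfold conjg; wsec.
    rewrite !sec_node.
    fold g0 g1; destruct (g []); simpl; fold g0 g1; wgrp; intro H.
    - rewrite <- (subgroup_inv G _ subgroup_G).
      rewrite <- (normalizer_conj G g0) by auto.
      revert H; unfold conjg, q; now wgrp.
    - rewrite <- (normalizer_conj G g0) by auto.
      revert H; unfold conjg, q; now wgrp. }
  assert (HqG : G q).
  { destruct (normalizer_G_decomp q Hq) as (t & k & d & Ht & Hk & Hd & E).
    rewrite E in Hqq, Hu |- *; destruct Hd as [-> | ->].
    - rewrite mulg1 in Hqq |- *; apply G_mul; [|exact Hk].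
      apply T_square_G; [exact Ht|].
      (* Expanding [(t k)^2] as [t^2] times the conjugate of [k] by [t] times [k] isolates [t^2]
         modulo [G]. *)
      rewrite <- (subgroup_mulr G _ (conjg t k ** k) subgroup_G).
      + revert Hqq; unfold conjg; now wgrp.
      + apply G_mul; [|exact Hk].
        now apply (normalizer_conj G t k (normalizer_T t Ht)).
    - exfalso; destruct T_not_G as (u & HuT & HuG); apply HuG.
      apply T_square_G; [exact HuT|].
      rewrite <- (subgroup_inv G _ subgroup_G), invMg.
      pose proof (Hu u HuT) as H.
      rewrite <- !conj_conj, (conj_comm t u) in H by now apply T_comm.
      (* Modulo [G], conjugation by [k] and by [t] fixes [u] while [delta] inverts it. So [H] puts
         [u^(-2)] in [G], against the choice of [u]. *)
      replace (conjg k u) with (u ** (conjg u (inv k) ** k)) in H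
        by (unfold conjg; now wgrp).
      rewrite conj_mul, delta_conj_T, <- mulA in H by exact HuT.
      revert H; apply (subgroup_mulr G); [exact subgroup_G|].
      apply (normalizer_conj G delta _ normalizer_delta), G_mul; [|exact Hk].
      apply (normalizer_conj G u _ (normalizer_T u HuT)), G_inv, Hk. }
  (* Since [q ** g0 = g1], the element [g] splits into [(1, q)] in [G], the diagonal [(g0, g0)] and
     a power of [sigma]. *)
  replace g with (node false one q ** node false g0 g0
                  ** if g [] then sigma else one).
  - apply normalizer_G_mul; [apply normalizer_G_mul|].
    + apply normalizer_G_incl, G_node; auto using G_one.
    + apply normalizer_G_diag, H0.
    + apply normalizer_G_incl; destruct (g []); auto using G_one, G_sigma.
  - rewrite node_mul, mul1g; unfold q; wgrp; apply W_ext.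
    + rewrite mul_root; simpl; now destruct (g []).
    + intro x; rewrite sec_mul, sec_node.
      destruct x, (g []); rewrite ?sec_sigma, ?sec_one; now wgrp.
Qed.

Theorem theorem4p14 :
  (countable_set G /\ layered G /\ abelianization_is_Z_plus_Z2inf G) /\
  (forall g, normalizer G g <->
     exists a d, gen (fun h => Fin h \/ T h) a /\ D d /\ g = mul a d) /\
  (forall g, normalizer (normalizer G) g <-> normalizer G g).
Proof.
  split; [|split].
  - split; [|split]; auto using countable_G, layered_G, abelianization_G.
  - exact normalizer_G_iff.
  - intro g; split; [apply normalizer_normalizer_G|].
    apply normalizer_incl, subgroup_normalizer.
Qed.
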